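(* Let $H_0>0$, $b_1,b_2\in\mathbb{R}$ be constants, let $\tilde t^0\in\mathbb{R}$, and let $f=f(t)$ satisfy $$\frac{df}{dt}+b_2\,(g+b_2f^2)\int_{\tilde t^0}^{t}f(t_1)\,dt_1=0,\qquad f(t_0)=f^0.$$ Define $$H(x,t)=\max\left(H_0-\frac{b_2}{2}\left(x-\int_{\tilde t^0}^{t}f(t_1)\,dt_1\right)^2,\,0\right),$$ $$u(x,z,t)=f(t)\,\mathbf{1}_{H>0},\qquad w(x,z,t)=b_2\,x\,f(t)\,\mathbf{1}_{H>0},\qquad z_b(x)=b_1+\frac{b_2}{2}x^2,$$ $$p(x,z,t)=(g+b_2f^2)(H+z_b-z)\,\mathbf{1}_{H>0},\qquad s(x,z,t)=b_2\,x\,\frac{df}{dt}.$$ Then $u,w,H,z_b,p$ satisfy, in the fluid region ($H>0$, $z_b\le z\le\eta=H+z_b$), the two-dimensional incompressible Euler equations with free surface and external forcing $s$, $$\frac{\partial H}{\partial t}+\frac{\partial}{\partial x}\int_{z_b}^{\eta}u\,dz=0,\qquad w=-\frac{\partial}{\partial x}\int_{z_b}^{z}u\,dz,$$ $$\frac{\partial u}{\partial t}+u\frac{\partial u}{\partial x}+w\frac{\partial u}{\partial z}+\frac{\partial p}{\partial x}=0,\qquad \frac{\partial w}{\partial t}+u\frac{\partial w}{\partial x}+w\frac{\partial w}{\partial z}+\frac{\partial p}{\partial z}=-g+s,$$ together with the free-surface boundary condition $p|_{z=\eta}=0$ (zero atmospheric pressure).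
   Context: $x\in\mathbb{R}$ is the horizontal coordinate, $z$ the vertical one, $t$ time (in the interval where $f$ is defined), $g$ the constant gravity acceleration. $z_b(x)$ is the bottom elevation, $H(x,t)$ the water height, $\eta=H+z_b$ the free-surface elevation, $(u,w)$ the velocity, $p$ the pressure. $\mathbf{1}_{H>0}$ equals $1$ where $H(x,t)>0$ and $0$ elsewhere. *)

(* Defs.v *)
From Stdlib Require Import Reals.
From Coquelicot Require Import Coquelicot.
Open Scope R_scope.

(* A real interval of any kind (open, closed, half-open, bounded or not),
   not reduced to a point. *)
Definition nondegenerate_interval (T : R -> Prop) : Prop :=
  (forall a b c : R, T a -> T c -> a <= b <= c -> T b) /\
  (exists a b : R, T a /\ T b /\ a < b).

(* Derivative at t of a function of time relative to the time interval T.
   [is_derive h t l] unfolds to the same formula with [locally t] for the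
   filter, so both agree when t is interior to T; at an endpoint belonging
   to T this is the one-sided derivative.  To be used for t in T. *)
Definition is_derive_on (T : R -> Prop) (h : R -> R) (t l : R) : Prop :=
  filterdiff h (within T (locally t)) (fun y : R => scal y l).

Definition pos_indicator (h : R) : R := if Rlt_dec 0 h then 1 else 0.

Definition free_surface (H : R -> R -> R) (zb : R -> R) (x t : R) : R :=
  H x t + zb x.

Definition fluid (T : R -> Prop) (H : R -> R -> R) (zb : R -> R)
    (x z t : R) : Prop :=
  T t /\ 0 < H x t /\ zb x <= z <= free_surface H zb x t.

(* Argument order: H x t, zb x, and u x z t (same for w, p, s).  Each partial
   derivative is asserted to exist.  [RInt] being total, integrability in z is
   asserted separately, on a neighbourhood of x since the integrals are
   differentiated in x. *)
Record euler_free_surface (T : R -> Prop) (g : R)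
    (H : R -> R -> R) (zb : R -> R) (u w p s : R -> R -> R -> R) : Prop := {
  depth_integrable : forall x t : R, T t -> 0 < H x t ->
    locally x (fun y =>
      ex_RInt (fun z => u y z t) (zb y) (free_surface H zb y t));
  partial_depth_integrable : forall x z t : R, fluid T H zb x z t ->
    locally x (fun y => ex_RInt (fun z' => u y z' t) (zb y) z);
  mass_conservation : forall x t : R, T t -> 0 < H x t ->
    exists dH_dt dQ_dx : R,
      is_derive_on T (fun t' => H x t') t dH_dt /\
      is_derive
        (fun y => RInt (fun z => u y z t) (zb y) (free_surface H zb y t))
        x dQ_dx /\
      dH_dt + dQ_dx = 0;
  vertical_velocity : forall x z t : R, fluid T H zb x z t ->
    exists dq_dx : R,
      is_derive (fun y => RInt (fun z' => u y z' t) (zb y) z) x dq_dx /\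
      w x z t = - dq_dx;
  horizontal_momentum : forall x z t : R, fluid T H zb x z t ->
    exists du_dt du_dx du_dz dp_dx : R,
      is_derive_on T (fun t' => u x z t') t du_dt /\
      is_derive (fun y => u y z t) x du_dx /\
      is_derive (fun z' => u x z' t) z du_dz /\
      is_derive (fun y => p y z t) x dp_dx /\
      du_dt + u x z t * du_dx + w x z t * du_dz + dp_dx = 0;
  vertical_momentum : forall x z t : R, fluid T H zb x z t ->
    exists dw_dt dw_dx dw_dz dp_dz : R,
      is_derive_on T (fun t' => w x z t') t dw_dt /\
      is_derive (fun y => w y z t) x dw_dx /\
      is_derive (fun z' => w x z' t) z dw_dz /\
      is_derive (fun z' => p x z' t) z dp_dz /\
      dw_dt + u x z t * dw_dx + w x z t * dw_dz + dp_dz = - g + s x z t;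
  surface_pressure : forall x t : R, T t -> 0 < H x t ->
    p x (free_surface H zb x t) t = 0
}.

(* Only the values of f on the time interval matter below, and tt0 is the
   lower bound of its primitive. *)
Definition sol_F (f : R -> R) (tt0 t : R) : R := RInt f tt0 t.

Definition sol_H (H0 b2 tt0 : R) (f : R -> R) (x t : R) : R :=
  Rmax (H0 - b2 / 2 * (x - sol_F f tt0 t) ^ 2) 0.

Definition sol_zb (b1 b2 x : R) : R := b1 + b2 / 2 * x ^ 2.

Definition sol_u (H0 b2 tt0 : R) (f : R -> R) (x z t : R) : R :=
  f t * pos_indicator (sol_H H0 b2 tt0 f x t).

Definition sol_w (H0 b2 tt0 : R) (f : R -> R) (x z t : R) : R :=
  b2 * x * f t * pos_indicator (sol_H H0 b2 tt0 f x t).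

Definition sol_p (g H0 b1 b2 tt0 : R) (f : R -> R) (x z t : R) : R :=
  (g + b2 * f t ^ 2) * (sol_H H0 b2 tt0 f x t + sol_zb b1 b2 x - z)
  * pos_indicator (sol_H H0 b2 tt0 f x t).

(* df stands for the derivative of f on the time interval. *)
Definition sol_s (b2 : R) (df : R -> R) (x z t : R) : R := b2 * x * df t.

(* Main.v *)
Require Import Defs.
From Stdlib Require Import Reals Lra.
From Coquelicot Require Import Coquelicot.
Open Scope R_scope.

(** Where [H > 0] the indicators are locally constant, both in [x] and (by
    continuity of [F = RInt f tt0]) in [t], so everything reduces to
    [u = f], [w = b2 x f], [H = H0 - b2/2 (x - F)^2]. The free surface
    [H + zb = H0 + b1 + b2 x F - b2/2 F^2] is then affine in [x], so the
    horizontal momentum equation is exactly the ODE for [f]; the remaining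
    equations are identities using only [F' = f]. The analytic point is
    [F' = f] relative to the time interval [T], where [f] is controlled only on
    [T]: on a compact subinterval [f] is replaced by its continuous extension
    [f o clamp]. *)

(** * Calculus of derivatives relative to a time interval *)

Lemma within_locally_proper (T : R -> Prop) (t : R) :
  T t -> ProperFilter (within T (locally t)).
Proof.
intros Ht; split.
- intros P HP; exists t; exact (locally_singleton _ _ HP Ht).
- apply within_filter, locally_filter.
Qed.

Lemma within_locally_lim (T : R -> Prop) (t : R) :
  is_filter_lim (within T (locally t)) t.
Proof. intros P; apply filter_le_within. Qed.

Lemma is_derive_is_derive_on (T : R -> Prop) (h : R -> R) (t l : R) :
  T t -> is_derive h t l -> is_derive_on T h t l.
Proof.
intros Ht Hh.
assert (PF := within_locally_proper T t Ht).
exact (filterdiff_locally h t _ (within_locally_lim T t) Hh).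
Qed.

Lemma is_derive_on_ext_loc (T : R -> Prop) (h k : R -> R) (t l : R) :
  T t -> within T (locally t) (fun y => h y = k y) ->
  is_derive_on T h t l -> is_derive_on T k t l.
Proof.
intros Ht Heq Hh.
assert (PF := within_locally_proper T t Ht).
apply (filterdiff_ext_loc h k); trivial.
(* The two functions must also agree at every limit point of the filter. The only one is [t], and
   [T t] makes the eventual equality hold there. *)
intros x Hx.
rewrite <- (is_filter_lim_unique t x (within_locally_lim T t) Hx).
exact (locally_singleton _ _ Heq Ht).
Qed.

Lemma is_derive_on_continuous (T : R -> Prop) (h : R -> R) (t l : R) :
  is_derive_on T h t l -> filterlim h (within T (locally t)) (locally (h t)).
Proof.
intros Hh.
apply (filterdiff_continuous_aux (U := R_NormedModule) (V := R_NormedModule)).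
- eexists; exact Hh.
- apply within_locally_lim.
Qed.

(** Chain rule with an ordinary derivative outside: [h] is continuous relative to [T], so the image
    filter converges to [h t], and differentiability of [k] at [h t] restricts to that filter. *)
Lemma is_derive_on_comp (T : R -> Prop) (h k : R -> R) (t l m : R) :
  T t -> is_derive k (h t) m -> is_derive_on T h t l ->
  is_derive_on T (fun y => k (h y)) t (l * m).
Proof.
intros Ht Hk Hh.
assert (PF := within_locally_proper T t Ht).
assert (Hlim := is_derive_on_continuous T h t l Hh).
assert (PF' : ProperFilter (filtermap h (within T (locally t))))
  by (apply filtermap_proper_filter; exact PF).
apply filterdiff_ext_lin with (fun y : R => scal (scal y l) m).
- apply (filterdiff_comp h k _ (fun y : R => scal y m)); trivial.
  exact (filterdiff_locally k (h t) _ Hlim Hk).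
- intros y; unfold scal; simpl; unfold mult; simpl; ring.
Qed.

(** * Fundamental theorem of calculus relative to an interval *)

Definition clamp (a b x : R) : R := Rmax a (Rmin b x).

Lemma clamp_in (a b x : R) : a <= b -> a <= clamp a b x <= b.
Proof.
intros Hab; unfold clamp, Rmax, Rmin.
destruct (Rle_dec b x); destruct (Rle_dec a _); lra.
Qed.

Lemma clamp_id (a b x : R) : a <= x <= b -> clamp a b x = x.
Proof.
intros Hx; unfold clamp.
now rewrite (Rmin_right b x), Rmax_right by lra.
Qed.

Lemma clamp_dist (a b x y : R) : Rabs (clamp a b y - clamp a b x) <= Rabs (y - x).
Proof.
unfold clamp, Rmax, Rmin.
destruct (Rle_dec b x); destruct (Rle_dec b y);
  repeat destruct (Rle_dec a _); unfold Rabs; repeat destruct (Rcase_abs _); lra.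
Qed.

(** Clamping is 1-Lipschitz with values in [T], so it sends neighbourhoods of [x] into relative
    neighbourhoods of the clamped point, where continuity of [f] relative to [T] suffices. *)
Lemma continuous_clamp (T : R -> Prop) (f : R -> R) (a b : R) :
  a <= b -> (forall s, a <= s <= b -> T s) ->
  (forall s, T s -> filterlim f (within T (locally s)) (locally (f s))) ->
  forall x, continuous (fun y => f (clamp a b y)) x.
Proof.
intros Hab HT Hf x.
apply (filterlim_comp _ _ _ (clamp a b) f _ (within T (locally (clamp a b x)))).
- intros P [eps HP]; exists eps; intros y Hy.
  apply HP.
  + exact (Rle_lt_trans _ _ _ (clamp_dist a b x y) Hy).
  + now apply HT, clamp_in.
- now apply Hf, HT, clamp_in.
Qed.

(* [b] is [t] itself only when [t] is the right end of [T]. *)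
Lemma exists_right_bound (T : R -> Prop) (s t : R) :
  T s -> T t -> exists b, T b /\ s <= b /\ t <= b /\
    within T (locally t) (fun y => y <= b).
Proof.
intros Hs Ht.
destruct (Classical_Prop.classic (exists b, T b /\ t < b)) as [[b [Hb Htb]]|Hno].
- exists (Rmax b s).
  assert (Hbs := Rmax_l b s).
  repeat split.
  + unfold Rmax; destruct (Rle_dec b s); assumption.
  + apply Rmax_r.
  + lra.
  + assert (Hpos : 0 < b - t) by lra.
    exists (mkposreal _ Hpos); intros y Hy _.
    unfold ball in Hy; simpl in Hy; unfold AbsRing_ball, abs, minus, plus, opp in Hy;
      simpl in Hy.
    apply Rabs_def2 in Hy; lra.
- assert (Hle : forall y, T y -> y <= t).
  { intros y Hy; apply Rnot_lt_le; intros Hlt; apply Hno; now exists y. }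
  exists t; repeat split; auto with real.
  exists (mkposreal 1 Rlt_0_1); auto.
Qed.

(** Mirror image of the right bound: reflect [T] through 0, then pull the neighbourhood back along
    the continuous map [Ropp]. *)
Lemma exists_left_bound (T : R -> Prop) (s t : R) :
  T s -> T t -> exists a, T a /\ a <= s /\ a <= t /\
    within T (locally t) (fun y => a <= y).
Proof.
intros Hs Ht.
destruct (exists_right_bound (fun y => T (- y)) (- s) (- t)) as [b [Hb [Hsb [Htb Hloc]]]];
  try (rewrite Ropp_involutive; assumption).
exists (- b); repeat split; try lra; trivial.
assert (Hlim : filterlim Ropp (locally t) (locally (- t)))
  by apply (filterlim_opp (V := R_NormedModule)).
refine (filter_imp (F := locally t) _ _ _ (Hlim _ Hloc)).
intros y Hy HTy; rewrite Ropp_involutive in Hy; specialize (Hy HTy); lra.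
Qed.

Lemma is_derive_on_RInt (T : R -> Prop) (f : R -> R) (s t : R) :
  nondegenerate_interval T -> T s -> T t ->
  (forall y, T y -> filterlim f (within T (locally y)) (locally (f y))) ->
  is_derive_on T (fun y => RInt f s y) t (f t).
Proof.
intros [HT _] Hs Ht Hf.
destruct (exists_left_bound T s t Hs Ht) as [a [Ha [Has [Hat Haloc]]]].
destruct (exists_right_bound T s t Hs Ht) as [b [Hb [Hsb [Htb Hbloc]]]].
assert (Hc : forall x, continuous (fun y => f (clamp a b y)) x).
{ apply (continuous_clamp T); trivial; try lra.
  intros y Hy; now apply (HT a y b). }
apply (is_derive_on_ext_loc T (fun y => RInt (fun r => f (clamp a b r)) s y)); trivial.
- generalize (filter_and _ _ Haloc Hbloc).
  apply (filter_imp (F := within T (locally t))).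
  intros y [Hay Hyb].
  (* Both [s] and [y] lie in [[a, b]], hence so does the range of integration, and clamping is the
     identity there. *)
  apply RInt_ext; intros r [Hr1 Hr2].
  rewrite clamp_id; trivial.
  assert (a <= Rmin s y) by now apply Rmin_glb.
  assert (Rmax s y <= b) by now apply Rmax_lub.
  lra.
- apply is_derive_is_derive_on; trivial.
  rewrite <- (clamp_id a b t) at 2 by lra.
  apply (is_derive_RInt (fun r => f (clamp a b r)) _ s t); trivial.
  apply filter_forall; intros y.
  apply (RInt_correct (fun r => f (clamp a b r))), ex_RInt_continuous; auto.
Qed.

(** * The wet region: openness in space and in time *)

Lemma sol_H_pos (H0 b2 tt0 : R) (f : R -> R) (x t : R) :
  0 < sol_H H0 b2 tt0 f x t <-> 0 < H0 - b2 / 2 * (x - sol_F f tt0 t) ^ 2.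
Proof.
unfold sol_H, Rmax; destruct (Rle_dec _ 0); lra.
Qed.

Lemma sol_H_eq (H0 b2 tt0 : R) (f : R -> R) (x t : R) :
  0 < sol_H H0 b2 tt0 f x t ->
  sol_H H0 b2 tt0 f x t = H0 - b2 / 2 * (x - sol_F f tt0 t) ^ 2.
Proof.
unfold sol_H, Rmax; destruct (Rle_dec _ 0); lra.
Qed.

Lemma pos_indicator_pos (h : R) : 0 < h -> pos_indicator h = 1.
Proof. unfold pos_indicator; destruct (Rlt_dec 0 h); tauto. Qed.

(** Positivity of the maximum is positivity of a quadratic in [x], an open condition. This licenses
    dropping indicators and the maximum before differentiating in [x]. *)
Lemma locally_sol_H_pos (H0 b2 tt0 : R) (f : R -> R) (x t : R) :
  0 < sol_H H0 b2 tt0 f x t ->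
  locally x (fun y => 0 < sol_H H0 b2 tt0 f y t).
Proof.
intros Hpos; apply sol_H_pos in Hpos.
assert (Hc : continuous (fun y => H0 - b2 / 2 * (y - sol_F f tt0 t) ^ 2) x).
{ apply (ex_derive_continuous (V := R_NormedModule)); auto_derive; trivial. }
refine (filter_imp (F := locally x) _ _ _ (Hc _ (open_gt 0 _ Hpos))).
intros y Hy; now apply sol_H_pos.
Qed.

(** Same argument in time: the depth depends on time only through [sol_F], which is continuous
    relative to [T] since it has a derivative there. *)
Lemma within_sol_H_pos (H0 b2 tt0 : R) (f : R -> R) (T : R -> Prop) (x t l : R) :
  is_derive_on T (sol_F f tt0) t l -> 0 < sol_H H0 b2 tt0 f x t ->
  within T (locally t) (fun s => 0 < sol_H H0 b2 tt0 f x s).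
Proof.
intros HF Hpos; apply sol_H_pos in Hpos.
assert (Hc : continuous (fun r => H0 - b2 / 2 * (x - r) ^ 2) (sol_F f tt0 t)).
{ apply (ex_derive_continuous (V := R_NormedModule)); auto_derive; trivial. }
refine (filter_imp (F := within T (locally t)) _ _ _
  (is_derive_on_continuous _ _ _ _ HF _ (Hc _ (open_gt 0 _ Hpos)))).
intros y Hy; now apply sol_H_pos.
Qed.

(** The horizontal velocity, indicator included, is constant along each vertical; the bounds are
    left free to serve both the full-depth and the partial integral. *)
Lemma is_RInt_sol_u (H0 b2 tt0 : R) (f : R -> R) (y t a b : R) :
  0 < sol_H H0 b2 tt0 f y t ->
  is_RInt (fun z => sol_u H0 b2 tt0 f y z t) a b ((b - a) * f t).
Proof.
intros Hpos; unfold sol_u; rewrite pos_indicator_pos by trivial.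
rewrite Rmult_1_r; apply (is_RInt_const a b (f t)).
Qed.

Theorem proposition3
  (g H0 b1 b2 t0 tt0 f0 : R) (T : R -> Prop) (f df : R -> R)
  (hH0 : 0 < H0)
  (hT : nondegenerate_interval T) (ht0 : T t0) (htt0 : T tt0)
  (hdf : forall t : R, T t -> is_derive_on T f t (df t))
  (hode : forall t : R, T t ->
     df t + b2 * (g + b2 * f t ^ 2) * RInt f tt0 t = 0)
  (hinit : f t0 = f0) :
  euler_free_surface T g
    (sol_H H0 b2 tt0 f) (sol_zb b1 b2)
    (sol_u H0 b2 tt0 f) (sol_w H0 b2 tt0 f)
    (sol_p g H0 b1 b2 tt0 f) (sol_s b2 df).
Proof.
assert (HF : forall t, T t -> is_derive_on T (sol_F f tt0) t (f t)).
{ intros t Ht; apply (is_derive_on_RInt T f tt0 t); trivial.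
  intros y Hy; apply (is_derive_on_continuous T f y (df y)); auto. }
split.
- intros x t Ht Hpos.
  generalize (locally_sol_H_pos _ _ _ _ _ _ Hpos); apply filter_imp.
  intros y Hy; eexists; now apply is_RInt_sol_u.
- intros x z t [Ht [Hpos Hz]].
  generalize (locally_sol_H_pos _ _ _ _ _ _ Hpos); apply filter_imp.
  intros y Hy; eexists; now apply is_RInt_sol_u.
- intros x t Ht Hpos.
  (* With [sol_F] moving at speed [f], the depth is a profile translated at speed [f], and the flux
     is depth times [f]; the two derivatives are opposite. *)
  exists (f t * (b2 * (x - sol_F f tt0 t))), (- (b2 * (x - sol_F f tt0 t)) * f t).
  split; [|split; [|ring]].
  + apply (is_derive_on_ext_loc T
      (fun s => H0 - b2 / 2 * (x - sol_F f tt0 s) ^ 2)); trivial.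
    * generalize (within_sol_H_pos _ _ _ _ _ _ _ _ (HF t Ht) Hpos).
      apply (filter_imp (F := within T (locally t))).
      intros s Hs; symmetry; now apply sol_H_eq.
    * apply (is_derive_on_comp T (sol_F f tt0) (fun r => H0 - b2 / 2 * (x - r) ^ 2));
        auto.
      auto_derive; trivial; field.
  + apply (is_derive_ext_loc
      (fun y => (H0 - b2 / 2 * (y - sol_F f tt0 t) ^ 2) * f t)).
    * generalize (locally_sol_H_pos _ _ _ _ _ _ Hpos); apply filter_imp.
      intros y Hy; symmetry; apply is_RInt_unique.
      (* The quadratic is the depth, that is, the length of the vertical segment of integration. *)
      replace (_ * f t) with
        ((free_surface (sol_H H0 b2 tt0 f) (sol_zb b1 b2) y t - sol_zb b1 b2 y) * f t).
      -- now apply is_RInt_sol_u.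
      -- unfold free_surface; rewrite sol_H_eq by trivial; ring.
    * auto_derive; trivial; field.
- intros x z t [Ht [Hpos Hz]].
  exists (- (b2 * x) * f t); split.
  + apply (is_derive_ext_loc (fun y => (z - sol_zb b1 b2 y) * f t)).
    * generalize (locally_sol_H_pos _ _ _ _ _ _ Hpos); apply filter_imp.
      intros y Hy; symmetry; now apply is_RInt_unique, is_RInt_sol_u.
    * unfold sol_zb; auto_derive; trivial; field.
  + unfold sol_w; rewrite pos_indicator_pos by trivial; ring.
- intros x z t [Ht [Hpos Hz]].
  (* Locally [u] depends on time alone, and the free surface is affine in [x] with slope
     [b2 * sol_F f tt0 t], which gives the pressure gradient. *)
  exists (df t), 0, 0, ((g + b2 * f t ^ 2) * (b2 * sol_F f tt0 t)).
  refine (conj _ (conj _ (conj _ (conj _ _)))).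
  + apply (is_derive_on_ext_loc T f); auto.
    generalize (within_sol_H_pos _ _ _ _ _ _ _ _ (HF t Ht) Hpos).
    apply (filter_imp (F := within T (locally t))).
    intros s Hs; unfold sol_u; rewrite pos_indicator_pos by auto; ring.
  + apply (is_derive_ext_loc (fun _ => f t)).
    * generalize (locally_sol_H_pos _ _ _ _ _ _ Hpos); apply filter_imp.
      intros y Hy; unfold sol_u; rewrite pos_indicator_pos by trivial.
      symmetry; apply Rmult_1_r.
    * apply (is_derive_const (f t)).
  + apply (is_derive_const (sol_u H0 b2 tt0 f x z t)).
  + apply (is_derive_ext_loc (fun y => (g + b2 * f t ^ 2) *
      (H0 - b2 / 2 * (y - sol_F f tt0 t) ^ 2 + (b1 + b2 / 2 * y ^ 2) - z))).
    * generalize (locally_sol_H_pos _ _ _ _ _ _ Hpos); apply filter_imp.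
      intros y Hy; unfold sol_p, sol_zb.
      rewrite pos_indicator_pos, sol_H_eq by trivial.
      symmetry; apply Rmult_1_r.
    * auto_derive; trivial; field.
  (* With the advection terms zero, what remains is exactly the differential equation for [f]. *)
  + generalize (hode t Ht); unfold sol_F; lra.
- intros x z t [Ht [Hpos Hz]].
  (* The time derivative of [w] equals the forcing [s], and the advection term
     [u * dw_dx = b2 * f t ^ 2] cancels the non-hydrostatic part of [dp_dz], leaving [- g]. *)
  exists (df t * (b2 * x)), (b2 * f t), 0, (- (g + b2 * f t ^ 2)).
  refine (conj _ (conj _ (conj _ (conj _ _)))).
  + apply (is_derive_on_ext_loc T (fun s => b2 * x * f s)); trivial.
    * generalize (within_sol_H_pos _ _ _ _ _ _ _ _ (HF t Ht) Hpos).
      apply (filter_imp (F := within T (locally t))).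
      intros s Hs; unfold sol_w; rewrite pos_indicator_pos by auto; ring.
    * apply (is_derive_on_comp T f (fun r => b2 * x * r)); auto.
      auto_derive; trivial; ring.
  + apply (is_derive_ext_loc (fun y => b2 * y * f t)).
    * generalize (locally_sol_H_pos _ _ _ _ _ _ Hpos); apply filter_imp.
      intros y Hy; unfold sol_w; rewrite pos_indicator_pos by trivial.
      symmetry; apply Rmult_1_r.
    * auto_derive; trivial; ring.
  + apply (is_derive_const (sol_w H0 b2 tt0 f x z t)).
  + unfold sol_p; rewrite pos_indicator_pos by trivial.
    auto_derive; trivial; ring.
  + unfold sol_u, sol_s; rewrite pos_indicator_pos by trivial; ring.
(* The factor [H + zb - z] of the pressure vanishes at the free surface. *)
- intros x t Ht Hpos; unfold sol_p, free_surface; ring.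
Qed.
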